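(* Let the four dimensional vector $g^\mu$ and the four dimensional matrix $\mathscr G^{\mu\nu}$ such that $$g^\mu=\begin{pmatrix} g^0\\ \mathbf g^1\end{pmatrix},\qquad \mathscr G^{\mu\nu}=\begin{pmatrix} G^0&(\mathbf G^1)^T\\ \mathbf G^2&\mathsf G^3\end{pmatrix},$$ for some $g^0,G^0\in\mathbb R$, $\mathbf g^1,\mathbf G^1,\mathbf G^2\in\mathbb R^3$, $\mathsf G^3\in\mathbb R^{3\times3}$, be Lorentz invariant (contravariant) tensors. Let $\mathbf v$ be the velocity field of particles. Then $${}^*g^0\equiv g^0-\mathbf v\cdot\mathbf g^1/c,\qquad {}^*\mathbf g^1\equiv\mathbf g^1-g^0\mathbf v/c,$$ and $${}^*G^0\equiv G^0-\mathbf G^1\cdot\mathbf v/c-\mathbf v\cdot\mathbf G^2/c+\mathbf v\cdot\mathsf G^3\mathbf v/c^2,$$ $${}^*\mathbf G^1\equiv\mathbf G^1-G^0\mathbf v/c+(\mathbf v\cdot\mathbf G^2)\mathbf v/c^2-(\mathsf G^3)^T\mathbf v/c,$$ $${}^*\mathbf G^2\equiv\mathbf G^2-G^0\mathbf v/c+(\mathbf v\cdot\mathbf G^1)\mathbf v/c^2-\mathsf G^3\mathbf v/c,$$ $${}^*\mathsf G^3\equiv\mathsf G^3+G^0\,\mathbf v\otimes\mathbf v/c^2-\mathbf v\otimes\mathbf G^1/c-\mathbf G^2\otimes\mathbf v/c$$ are Galilean invariant within the semi-relativistic limit.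
   Context: Three dimensional vectors are columns, $\mathbf a\otimes\mathbf b=\mathbf a\mathbf b^T$, $\mathbb I$ is the $3\times3$ identity, $c$ is the speed of light in vacuum. $g^0,\mathbf g^1,G^0,\dots$ are fields. Lorentz invariance: Minkowski spacetime has metric $\eta_{\mu\nu}=\mathrm{diag}(1,-\mathbb I)$ and events $\mathcal X^\mu=\{ct;\mathbf x\}$. A Lorentz transformation is a $4\times4$ matrix ${\Lambda^\mu}_\nu$ with $\eta_{\mu\nu}{\Lambda^\mu}_\alpha{\Lambda^\nu}_\beta=\eta_{\alpha\beta}$, acting by $\mathcal X'^\mu={\Lambda^\mu}_\nu\mathcal X^\nu$. A four-vector field $g^\mu$ or four-tensor field $\mathscr G^{\mu\nu}$ is Lorentz invariant (contravariant) if it transforms as $g'^\mu(\mathcal X')={\Lambda^\mu}_\nu g^\nu(\mathcal X)$, respectively $\mathscr G'^{\mu\nu}(\mathcal X')={\Lambda^\mu}_\alpha{\Lambda^\nu}_\beta\mathscr G^{\alpha\beta}(\mathcal X)$. Galilean invariance: a Galilean transformation of $\mathbb R^3$ is $\mathbf x'=\mathsf Q\mathbf x+\mathbf c$, with $\mathsf Q\in SO(3)$ and $\mathbf c\in\mathbb R^3$ a uniform translation; a pure Galilean boost of velocity $\mathbf u$ is the case $\mathsf Q=\mathbb I$, $\mathbf c=-\mathbf ut$. A scalar, vector or second-rank tensor field is Galilean invariant if it transforms as $g'(\mathbf x')=g(\mathbf x)$, $\mathbf g'(\mathbf x')=\mathsf Q\mathbf g(\mathbf x)$, $\mathsf G'(\mathbf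 x')=\mathsf Q\mathsf G(\mathbf x)\mathsf Q^T$, respectively. With $\mathbf c=-\mathsf Q\mathbf ut$ the velocity field transforms as $\mathbf v'=\mathsf Q(\mathbf v-\mathbf u)$. Semi-relativistic limit: a problem is within this limit if, for a number $\epsilon<1$ so small that terms of order $\mathcal O(\epsilon^2)$ can be dropped: (I) all measurements are done in inertial frames whose relative velocities $\mathbf u$ satisfy $|\mathbf u|/c\lesssim\epsilon$; (II) in any inertial frame the velocity field of particles satisfies $|\mathbf v|/c\lesssim\epsilon$; (III) the length and time scales $[x],[t]$ of the problem, which are such that $[\partial_t^m\nabla^nf]\sim[f]/([t]^m[x]^n)$ for every field $f$ under consideration and all $0\le m,n<\infty$ ($[\cdot]$ denoting typical value), satisfy $[x]\lesssim\epsilon c[t]$. In this limit the Lorentz boost of velocity $\mathbf u$ becomes $$\Lambda_{\rm b\text{-}sr}=\begin{pmatrix}1&-\mathbf u^T/c\\-\mathbf u/c&\mathbb I\end{pmatrix},$$ which on events is equivalent, within the limit, to the Galilean boost of velocity $\mathbf u$. The components of Lorentz tensors in the boosted frame are obtained by applying $\Lambda_{\rm b\text{-}sr}$; rotations pose no difficulty, so only pure boosts need to be considered. *)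

(* Defs.v *)
From HB Require Import structures.
From mathcomp Require Import all_boot all_order all_algebra.
From mathcomp Require Import all_classical all_reals all_analysis.

Set Implicit Arguments.
Unset Strict Implicit.
Unset Printing Implicit Defensive.

Import Order.TTheory GRing.Theory Num.Theory.
Import numFieldNormedType.Exports.

Local Open Scope ring_scope.

(* On columns and matrices `|.| is the library norm (the
   maximum of the entries).  Each norm below is compared with another quantity
   only up to an implied constant, so the Euclidean norm would give an
   equivalent theory. *)

Definition dot (R : realType) (a b : 'cV[R]_3) : R := (a^T *m b) 0 0.

(* a (x) b = a b^T *)
Definition outer (R : realType) (a b : 'cV[R]_3) : 'M[R]_3 := a *m b^T.

Definition SO3 (R : realType) (Q : 'M[R]_3) : Prop :=
  Q *m Q^T = 1%:M /\ \det Q = 1.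

(* {ct; x} *)
Definition event (R : realType) (c t : R) (x : 'cV[R]_3) : 'cV[R]_(1 + 3) :=
  col_mx (c * t)%:M x.

Definition four_vector (R : realType) (g0 : 'cV[R]_(1 + 3) -> R)
    (g1 : 'cV[R]_(1 + 3) -> 'cV[R]_3) (X : 'cV[R]_(1 + 3)) : 'cV[R]_(1 + 3) :=
  col_mx (g0 X)%:M (g1 X).

Definition four_tensor (R : realType) (G0 : 'cV[R]_(1 + 3) -> R)
    (G1 G2 : 'cV[R]_(1 + 3) -> 'cV[R]_3) (G3 : 'cV[R]_(1 + 3) -> 'M[R]_3)
    (X : 'cV[R]_(1 + 3)) : 'M[R]_(1 + 3) :=
  block_mx (G0 X)%:M (G1 X)^T (G2 X) (G3 X).

Definition boost_sr (R : realType) (c : R) (u : 'cV[R]_3) : 'M[R]_(1 + 3) :=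
  block_mx 1%:M (- (c^-1 *: u^T)) (- (c^-1 *: u)) 1%:M.

Definition lorentz_sr (R : realType) (c : R) (Q : 'M[R]_3) (u : 'cV[R]_3) :
    'M[R]_(1 + 3) :=
  block_mx 1%:M 0 0 Q *m boost_sr c u.

(* Transformation laws of contravariant fields: unprimed arguments are the
   components in the first frame, primed ones those in the second frame, each
   as a function of the event coordinates of its own frame. *)
Definition lorentz_vector (R : realType) (L : 'M[R]_(1 + 3))
    (g g' : 'cV[R]_(1 + 3) -> 'cV[R]_(1 + 3)) : Prop :=
  forall X, g' (L *m X) = L *m g X.

Definition lorentz_tensor (R : realType) (L : 'M[R]_(1 + 3))
    (G G' : 'cV[R]_(1 + 3) -> 'M[R]_(1 + 3)) : Prop :=
  forall X, G' (L *m X) = L *m G X *m L^T.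

(* x' = Q x + c with c = - Q u t, at the common time t. *)
Definition galilean (R : realType) (Q : 'M[R]_3) (u : 'cV[R]_3) (t : R)
    (x : 'cV[R]_3) : 'cV[R]_3 :=
  Q *m x - t *: (Q *m u).

Definition velocity_law (R : realType) (c : R) (Q : 'M[R]_3) (u : 'cV[R]_3)
    (v v' : 'cV[R]_(1 + 3) -> 'cV[R]_3) : Prop :=
  forall t x, v' (event c t (galilean Q u t x)) = Q *m (v (event c t x) - u).

Record problem (R : realType) := Problem {
  lightspeed : R;
  smallness : R;
  length_scale : R;
  time_scale : R }.

(* Positions of the problem are of the order of its length scale. *)
Definition in_range (R : realType) (K : R) (p : problem R) (x : 'cV[R]_3) :
    Prop :=
  `|x| <= K * length_scale p.

Definition partial_t (R : realType) (V : normedModType R) (c : R)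
    (f : 'cV[R]_(1 + 3) -> V) : 'cV[R]_(1 + 3) -> V :=
  fun X => 'D_(event c 1 0) f X.

Definition partial_x (R : realType) (V : normedModType R) (i : 'I_3)
    (f : 'cV[R]_(1 + 3) -> V) : 'cV[R]_(1 + 3) -> V :=
  fun X => 'D_(col_mx 0 (delta_mx i 0)) f X.

(* The entries of d_t^m nabla^n f are the partials m s f with size s = n. *)
Definition partials (R : realType) (V : normedModType R) (c : R) (m : nat)
    (s : seq 'I_3) (f : 'cV[R]_(1 + 3) -> V) : 'cV[R]_(1 + 3) -> V :=
  iter m (partial_t c) (foldr (@partial_x R V) f s).

Definition smooth (R : realType) (V : normedModType R) (c : R)
    (f : 'cV[R]_(1 + 3) -> V) : Prop :=
  forall m s X, differentiable (partials c m s f) X.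

(* [f] = F, with d_t^m nabla^n f of order at most F / ([t]^m [x]^n); the
   implied constant of order (m, n) is A m n. *)
Definition has_scale (R : realType) (V : normedModType R) (K : R)
    (A : nat -> nat -> R) (p : problem R) (F : R)
    (f : 'cV[R]_(1 + 3) -> V) : Prop :=
  smooth (lightspeed p) f /\
  forall m s t x, in_range K p x ->
    `|partials (lightspeed p) m s f (event (lightspeed p) t x)|
      <= A m (size s) * (F / (time_scale p ^+ m * length_scale p ^+ size s)).

(* F is a typical value of a field with representatives f, f' in two frames. *)
Definition typical (R : realType) (V : normedModType R) (K : R)
    (A : nat -> nat -> R) (p : problem R) (F : R)
    (f f' : 'cV[R]_(1 + 3) -> V) : Prop :=
  [/\ 0 <= F, has_scale K A p F f & has_scale K A p F f'].

(* Conditions (I), (II) and, for the scales themselves, (III) for two frames of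
   relative velocity u; the estimates on the fields in (III) are [typical]. *)
Definition semi_relativistic (R : realType) (K : R) (p : problem R)
    (u : 'cV[R]_3) (v v' : 'cV[R]_(1 + 3) -> 'cV[R]_3) : Prop :=
  let c := lightspeed p in
  let eps := smallness p in
  [/\ [/\ 0 < c, 0 < eps < 1, 0 < length_scale p & 0 < time_scale p],
      `|u| / c <= K * eps,
      forall t x, in_range K p x ->
        `|v (event c t x)| / c <= K * eps /\
        `|v' (event c t x)| / c <= K * eps
    & length_scale p <= K * (eps * c * time_scale p)].

(* Galilean invariance up to an error err. *)
Definition galilean_scalar (R : realType) (K : R) (p : problem R)
    (Q : 'M[R]_3) (u : 'cV[R]_3) (err : R) (f f' : 'cV[R]_(1 + 3) -> R) :
    Prop :=
  forall t x, in_range K p x -> in_range K p (galilean Q u t x) ->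
    `|f' (event (lightspeed p) t (galilean Q u t x))
      - f (event (lightspeed p) t x)| <= err.

Definition galilean_vector (R : realType) (K : R) (p : problem R)
    (Q : 'M[R]_3) (u : 'cV[R]_3) (err : R)
    (f f' : 'cV[R]_(1 + 3) -> 'cV[R]_3) : Prop :=
  forall t x, in_range K p x -> in_range K p (galilean Q u t x) ->
    `|f' (event (lightspeed p) t (galilean Q u t x))
      - Q *m f (event (lightspeed p) t x)| <= err.

Definition galilean_tensor (R : realType) (K : R) (p : problem R)
    (Q : 'M[R]_3) (u : 'cV[R]_3) (err : R)
    (f f' : 'cV[R]_(1 + 3) -> 'M[R]_3) : Prop :=
  forall t x, in_range K p x -> in_range K p (galilean Q u t x) ->
    `|f' (event (lightspeed p) t (galilean Q u t x))
      - Q *m f (event (lightspeed p) t x) *m Q^T| <= err.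

Definition star_g0 (R : realType) (c : R) (v : 'cV[R]_(1 + 3) -> 'cV[R]_3)
    (g0 : 'cV[R]_(1 + 3) -> R) (g1 : 'cV[R]_(1 + 3) -> 'cV[R]_3) :
    'cV[R]_(1 + 3) -> R :=
  fun X => g0 X - dot (v X) (g1 X) / c.

Definition star_g1 (R : realType) (c : R) (v : 'cV[R]_(1 + 3) -> 'cV[R]_3)
    (g0 : 'cV[R]_(1 + 3) -> R) (g1 : 'cV[R]_(1 + 3) -> 'cV[R]_3) :
    'cV[R]_(1 + 3) -> 'cV[R]_3 :=
  fun X => g1 X - (g0 X / c) *: v X.

Definition star_G0 (R : realType) (c : R) (v : 'cV[R]_(1 + 3) -> 'cV[R]_3)
    (G0 : 'cV[R]_(1 + 3) -> R) (G1 G2 : 'cV[R]_(1 + 3) -> 'cV[R]_3)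
    (G3 : 'cV[R]_(1 + 3) -> 'M[R]_3) : 'cV[R]_(1 + 3) -> R :=
  fun X => G0 X - dot (G1 X) (v X) / c - dot (v X) (G2 X) / c
           + dot (v X) (G3 X *m v X) / c ^+ 2.

Definition star_G1 (R : realType) (c : R) (v : 'cV[R]_(1 + 3) -> 'cV[R]_3)
    (G0 : 'cV[R]_(1 + 3) -> R) (G1 G2 : 'cV[R]_(1 + 3) -> 'cV[R]_3)
    (G3 : 'cV[R]_(1 + 3) -> 'M[R]_3) : 'cV[R]_(1 + 3) -> 'cV[R]_3 :=
  fun X => G1 X - (G0 X / c) *: v X + (dot (v X) (G2 X) / c ^+ 2) *: v X
           - c^-1 *: ((G3 X)^T *m v X).

Definition star_G2 (R : realType) (c : R) (v : 'cV[R]_(1 + 3) -> 'cV[R]_3)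
    (G0 : 'cV[R]_(1 + 3) -> R) (G1 G2 : 'cV[R]_(1 + 3) -> 'cV[R]_3)
    (G3 : 'cV[R]_(1 + 3) -> 'M[R]_3) : 'cV[R]_(1 + 3) -> 'cV[R]_3 :=
  fun X => G2 X - (G0 X / c) *: v X + (dot (v X) (G1 X) / c ^+ 2) *: v X
           - c^-1 *: (G3 X *m v X).

Definition star_G3 (R : realType) (c : R) (v : 'cV[R]_(1 + 3) -> 'cV[R]_3)
    (G0 : 'cV[R]_(1 + 3) -> R) (G1 G2 : 'cV[R]_(1 + 3) -> 'cV[R]_3)
    (G3 : 'cV[R]_(1 + 3) -> 'M[R]_3) : 'cV[R]_(1 + 3) -> 'M[R]_3 :=
  fun X => G3 X + (G0 X / c ^+ 2) *: outer (v X) (v X)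
           - c^-1 *: outer (v X) (G1 X) - c^-1 *: outer (G2 X) (v X).

(* Main.v *)
(* Both starred families are boosts to the rest frame of the particles:
   [*g = B(v) g] and [*G = B(v) G B(v)^T], where [B(w)] is the semi-relativistic
   boost of velocity [w].  With [L = diag(1, Q) B(u)] the change of frames and
   [v' = Q (v - u)], the composition of boosts gives
   [B(v') L = diag(1, Q) (B(v) + E)] with [E] block diagonal and of order
   [|v - u| |u| / c^2 = O(eps^2)], so the starred fields change by the rotation
   alone up to [O(eps^2)].  The Lorentz transformation moves the event
   [(t, x)] to the time [t - u.x / c^2] instead of [t]; by the mean value
   theorem and [[x] <= eps c [t]] this costs another relative error
   [O(eps^2)].  All estimates are entrywise: [B(w)] is bounded by a multiple of
   [beta = (1, eps; eps, 1)] (constant blocks), [beta] is stable under products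
   up to a factor, and [beta s], [beta S beta^T] are, up to a factor, the sizes
   of the starred fields. *)
Require Import Defs.
From HB Require Import structures.
From mathcomp Require Import all_boot all_order all_algebra.
From mathcomp Require Import all_classical all_reals all_analysis.
From mathcomp Require Import ring lra.
Import Order.TTheory GRing.Theory Num.Theory.
Import numFieldNormedType.Exports.
Local Open Scope ring_scope.

Set Implicit Arguments.
Unset Strict Implicit.
Unset Printing Implicit Defensive.

(** Bounds are entrywise rather than in norm, because the blocks of a four-tensor carry different
    powers of eps. The relation makes [N] nonnegative, so bounds can be multiplied. *)
Definition mx_bound (R : numDomainType) m n (N M : 'M[R]_(m, n)) : Prop :=
  forall i j, `|M i j| <= N i j.

(** * Entrywise bounds for matrices and their blocks *)

Section MatrixBounds.
Variable R : realType.

Lemma mx_norm_leP m n (M : 'M[R]_(m, n)) (r : R) : 0 <= r ->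
  `|M| <= r <-> forall i j, `|M i j| <= r.
Proof.
move=> r0; split=> [Mr i j|Mr].
  apply: le_trans Mr; rewrite [leRHS]/Num.norm /= mx_normrE.
  by apply/bigmax_geP; right; exists (i, j).
by rewrite [leLHS]/Num.norm /= mx_normrE; apply/bigmax_leP; split.
Qed.

Lemma mx_bound_const m n (M : 'M[R]_(m, n)) (r : R) :
  `|M| <= r -> mx_bound (const_mx r) M.
Proof.
move=> Mr i j; rewrite mxE.
by have /mx_norm_leP-> := Mr; rewrite // (le_trans _ Mr).
Qed.

Lemma mx_bound_trans m n (N' N M : 'M[R]_(m, n)) :
  mx_bound N M -> mx_bound N' N -> mx_bound N' M.
Proof.
by move=> MN NN' i j; exact: le_trans (MN i j) (le_trans (ler_norm _) (NN' i j)).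
Qed.

Lemma mx_boundD m n (N N' M M' : 'M[R]_(m, n)) :
  mx_bound N M -> mx_bound N' M' -> mx_bound (N + N') (M + M').
Proof.
by move=> MN MN' i j; rewrite !mxE (le_trans (ler_normD _ _)) ?lerD.
Qed.

Lemma mx_boundT m n (N M : 'M[R]_(m, n)) : mx_bound N M -> mx_bound N^T M^T.
Proof. by move=> MN i j; rewrite !mxE. Qed.

Lemma mx_boundZ m n (a : R) (N M : 'M[R]_(m, n)) :
  0 <= a -> mx_bound N M -> mx_bound (a *: N) (a *: M).
Proof. by move=> a0 MN i j; rewrite !mxE normrM ger0_norm ?ler_wpM2l. Qed.

Lemma mx_bound_mul m n p (N M : 'M[R]_(m, n)) (N' M' : 'M[R]_(n, p)) :
  mx_bound N M -> mx_bound N' M' -> mx_bound (N *m N') (M *m M').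
Proof.
move=> MN MN' i j; rewrite !mxE (le_trans (ler_norm_sum _ _ _)) //.
by apply: ler_sum => k _; rewrite normrM ler_pM.
Qed.

Lemma mx_bound_col m1 m2 n (N1 M1 : 'M[R]_(m1, n)) (N2 M2 : 'M[R]_(m2, n)) :
  mx_bound (col_mx N1 N2) (col_mx M1 M2) <-> mx_bound N1 M1 /\ mx_bound N2 M2.
Proof.
split=> [MN|[MN1 MN2] i j].
  by split=> i j; [have := MN (lshift _ i) j | have := MN (rshift _ i) j];
     rewrite ?col_mxEu ?col_mxEd.
by rewrite -(splitK i); case: (fintype.split i) => k /=;
   rewrite ?col_mxEu ?col_mxEd.
Qed.

Lemma mx_bound_row m n1 n2 (N1 M1 : 'M[R]_(m, n1)) (N2 M2 : 'M[R]_(m, n2)) :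
  mx_bound (row_mx N1 N2) (row_mx M1 M2) <-> mx_bound N1 M1 /\ mx_bound N2 M2.
Proof.
split=> [MN|[MN1 MN2] i j].
  by split=> i j; [have := MN i (lshift _ j) | have := MN i (rshift _ j)];
     rewrite ?row_mxEl ?row_mxEr.
by rewrite -(splitK j); case: (fintype.split j) => k /=;
   rewrite ?row_mxEl ?row_mxEr.
Qed.

Lemma mx_bound_block m1 m2 n1 n2 (N1 M1 : 'M[R]_(m1, n1)) (N2 M2 : 'M[R]_(m1, n2))
    (N3 M3 : 'M[R]_(m2, n1)) (N4 M4 : 'M[R]_(m2, n2)) :
  mx_bound (block_mx N1 N2 N3 N4) (block_mx M1 M2 M3 M4) <->
  [/\ mx_bound N1 M1, mx_bound N2 M2, mx_bound N3 M3 & mx_bound N4 M4].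
Proof.
rewrite /block_mx; split=> [/mx_bound_col[]/mx_bound_row[? ?]/mx_bound_row[]//|].
by case=> *; apply/mx_bound_col; split; apply/mx_bound_row.
Qed.

Lemma mulmx_const m n p (a b : R) :
  @const_mx _ m n a *m @const_mx _ n p b = const_mx (a * b *+ n).
Proof.
apply/matrixP => i j; rewrite !mxE.
by under eq_bigr do rewrite !mxE; rewrite sumr_const card_ord.
Qed.

(** One size per block. Such block-constant matrices are closed under products, which reduces matrix
    estimates to inequalities between four numbers; each sum over spatial indices contributes a
    factor 3. *)
Definition mx_sizes (s0 s1 s2 s3 : R) : 'M[R]_(1 + 3) :=
  block_mx (const_mx s0) (const_mx s1) (const_mx s2) (const_mx s3).

Definition col_sizes (s0 s1 : R) : 'cV[R]_(1 + 3) :=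
  col_mx (const_mx s0) (const_mx s1).

Lemma mulmx_sizes a b c d a' b' c' d' :
  mx_sizes a b c d *m mx_sizes a' b' c' d' =
  mx_sizes (a * a' + 3 * b * c') (a * b' + 3 * b * d')
           (c * a' + 3 * d * c') (c * b' + 3 * d * d').
Proof.
rewrite /mx_sizes mulmx_block !mulmx_const; congr block_mx;
  by apply/matrixP => i j; rewrite !mxE; ring.
Qed.

Lemma mul_mx_col_sizes a b c d s0 s1 :
  mx_sizes a b c d *m col_sizes s0 s1 =
  col_sizes (a * s0 + 3 * b * s1) (c * s0 + 3 * d * s1).
Proof.
rewrite /mx_sizes mul_block_col !mulmx_const; congr col_mx;
  by apply/matrixP => i j; rewrite !mxE; ring.
Qed.

Lemma scale_mx_sizes k a b c d :
  k *: mx_sizes a b c d = mx_sizes (k * a) (k * b) (k * c) (k * d).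
Proof. by rewrite /mx_sizes scale_block_mx !scalemx_const. Qed.

Lemma scale_col_sizes k a b : k *: col_sizes a b = col_sizes (k * a) (k * b).
Proof. by rewrite /col_sizes scale_col_mx !scalemx_const. Qed.

Lemma mx_bound_sizes a b c d a' b' c' d' :
  0 <= a <= a' -> 0 <= b <= b' -> 0 <= c <= c' -> 0 <= d <= d' ->
  mx_bound (mx_sizes a' b' c' d') (mx_sizes a b c d).
Proof.
by move=> /andP[a0 ?] /andP[b0 ?] /andP[c0 ?] /andP[d0 ?];
   apply/mx_bound_block; split=> i j; rewrite !mxE ger0_norm.
Qed.

(** By the diagonal entry at [i] of [Q *m Q^T = 1%:M], the squares in row [i] sum to 1, so none
    exceeds 1. *)
Lemma SO3_entry (Q : 'M[R]_3) i j : SO3 Q -> `|Q i j| <= 1.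
Proof.
case=> /matrixP/(_ i i); rewrite !mxE eqxx /=.
under eq_bigr do rewrite mxE -expr2; move=> QQ _.
rewrite -(@ler_pXn2r _ 2) ?nnegrE // expr1n real_normK ?num_real //.
rewrite -[leRHS]QQ (bigD1 j) //= lerDl sumr_ge0 // => k _.
exact: sqr_ge0.
Qed.

(** The norm is the maximum of the entries, so each of the three summands is at most the product of
    the norms. *)
Lemma dot_le (a b : 'cV[R]_3) : `|dot a b| <= 3 * `|a| * `|b|.
Proof.
have ha := mx_bound_const (lexx `|a|); have hb := mx_bound_const (lexx `|b|).
have := mx_bound_mul (mx_boundT ha) hb 0 0.
rewrite trmx_const mulmx_const => /le_trans-> //; first by rewrite mxE -mulr_natl mulrA.
Qed.

End MatrixBounds.

(** * Variation in time at a fixed position *)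

Section TimeShift.
Variables (R : realType) (c : R).

Lemma event_line (t : R) (x : 'cV[R]_3) : event c t x = event c 0 x + t *: event c 1 0.
Proof.
rewrite /event scale_col_mx add_col_mx scaler0 addr0; congr col_mx.
by apply/matrixP => i j; rewrite !mxE; case: (i == j); rewrite ?mulr1n ?mulr0n; ring.
Qed.

(** The mean value theorem for [h s = f (event c s x)]: as [event c s x] is affine in [s] with slope
    [event c 1 0], the derivative of [h] is the directional derivative of [f]. *)
Lemma time_shift (f : 'cV[R]_(1 + 3) -> R) (M : R) (x : 'cV[R]_3) :
  (forall t, derivable f (event c t x) (event c 1 0)) ->
  (forall t, `|'D_(event c 1 0) f (event c t x)| <= M) ->
  forall t t', `|f (event c t x) - f (event c t' x)| <= M * `|t - t'|.
Proof.
move=> df dfM t t'.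
pose h s := f (event c s x).
have quot (s : R) : (fun r : R => r^-1 *: (h (r *: 1 + s) - h s)) =
    (fun r : R => r^-1 *: (f (r *: event c 1 0 + event c s x) - f (event c s x))).
  apply/funext => r; rewrite /h; congr (_ *: (f _ - _)).
  by rewrite [in LHS]event_line [in RHS](event_line s) scalerDl /= addrCA [_ *: 1]mulr1.
have dh (s : R) : is_derive s (1 : R) h ('D_(event c 1 0) f (event c s x)).
  apply: DeriveDef.
    by rewrite /derivable /=; have := df s; rewrite /derivable /= -quot.
  by rewrite /derive /= quot.
wlog tt' : t t' / t' <= t => [wlg|].
  have [|/ltW tt] := leP t' t; first exact: wlg.
  by rewrite distrC (distrC t); exact: wlg.
have [] := @MVT_segment R h _ t' t tt' (fun s _ => dh s).
  apply: continuous_subspaceT => s; apply/differentiable_continuous/derivable1_diffP.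
  by have [] := dh s.
by move=> s _ hE; rewrite -!/(h _) hE normrM ler_wpM2r.
Qed.

(** The mean value theorem is applied to each entry separately; the norm of the matrix derivative
    dominates the derivative of every entry. *)
Lemma time_shift_mx m n (f : 'cV[R]_(1 + 3) -> 'M[R]_(m, n)) (M : R)
    (x : 'cV[R]_3) :
  (forall t, derivable f (event c t x) (event c 1 0)) ->
  (forall t, `|'D_(event c 1 0) f (event c t x)| <= M) ->
  forall t t' i j, `|f (event c t x) i j - f (event c t' x) i j| <= M * `|t - t'|.
Proof.
move=> df dfM t t' i j.
apply: (@time_shift (fun X => f X i j)) => s.
  by have /derivable_mxP := df s; exact.
apply: le_trans (dfM s); rewrite (derive_mx (df s)).
rewrite [leRHS]/Num.norm /= mx_normrE.
by apply/bigmax_geP; right; exists (i, j) => //=; rewrite mxE.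
Qed.

End TimeShift.

(** * Consequences of the typical scales *)

Section ScaleBounds.
Variables (R : realType) (K : R) (A : nat -> nat -> R) (p : problem R).
Let c := lightspeed p.
Let tau := time_scale p.
Hypothesis tau_gt0 : 0 < tau.

(** The scale estimate of order (0, 0) in the first frame. The absolute value makes the constant
    nonnegative. *)
Lemma typical_le (V : normedModType R) F (f f' : 'cV[R]_(1 + 3) -> V) t x :
  typical K A p F f f' -> in_range K p x ->
  `|f (event c t x)| <= `|A 0 0| * F.
Proof.
move=> [F0 [_ fF] _] xr; have := fF 0 [::] t x xr.
rewrite /= expr0 mulr1 divr1 => /le_trans; apply.
by rewrite ler_wpM2r ?ler_norm.
Qed.

(** The scale estimate of order (1, 0) bounds the time derivative by [|A 1 0| * F / tau]. It is
    stated for [f'], because the two times to be compared belong to the second frame. *)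
Lemma typical_shift (F : R) (f f' : 'cV[R]_(1 + 3) -> R) t t' x :
  typical K A p F f f' -> in_range K p x ->
  `|f' (event c t x) - f' (event c t' x)| <= `|A 1 0| * F * (`|t - t'| / tau).
Proof.
move=> [F0 _ [sf fF]] xr.
have -> : `|A 1 0| * F * (`|t - t'| / tau) = `|A 1 0| * F / tau * `|t - t'| by ring.
apply: time_shift => s; first exact/diff_derivable/(sf 0 [::]).
have := fF 1 [::] s x xr; rewrite /= expr0 mulr1 expr1 => /le_trans; apply.
by rewrite -mulrA ler_wpM2r ?ler_norm // divr_ge0 // ltW.
Qed.

Lemma typical_shift_mx m n (F : R) (f f' : 'cV[R]_(1 + 3) -> 'M[R]_(m, n)) t t' x :
  typical K A p F f f' -> in_range K p x ->
  forall i j, `|f' (event c t x) i j - f' (event c t' x) i j|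
    <= `|A 1 0| * F * (`|t - t'| / tau).
Proof.
move=> [F0 _ [sf fF]] xr i j.
have -> : `|A 1 0| * F * (`|t - t'| / tau) = `|A 1 0| * F / tau * `|t - t'| by ring.
apply: time_shift_mx => s; first exact/diff_derivable/(sf 0 [::]).
have := fF 1 [::] s x xr; rewrite /= expr0 mulr1 expr1 => /le_trans; apply.
by rewrite -mulrA ler_wpM2r ?ler_norm // divr_ge0 // ltW.
Qed.

End ScaleBounds.

(** * Starred fields as boosted fields, and composition of boosts *)

Definition rotation (R : realType) (Q : 'M[R]_3) : 'M[R]_(1 + 3) :=
  block_mx 1%:M 0 0 Q.
Arguments rotation {R} Q.

Section Star.
Variables (R : realType) (c : R).

Lemma star_four_vector v g0 g1 X :
  boost_sr c (v X) *m four_vector g0 g1 X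
  = four_vector (star_g0 c v g0 g1) (star_g1 c v g0 g1) X.
Proof.
rewrite /boost_sr /four_vector mul_block_col !mul1mx.
congr col_mx; apply/matrixP => i j;
  rewrite /star_g0 /star_g1 /dot ?ord1 !mxE ?big_ord_recl ?big_ord0 !mxE /=;
  by rewrite ?mulr1n; ring.
Qed.

Lemma star_four_tensor v G0 G1 G2 G3 X :
  boost_sr c (v X) *m four_tensor G0 G1 G2 G3 X *m (boost_sr c (v X))^T
  = four_tensor (star_G0 c v G0 G1 G2 G3) (star_G1 c v G0 G1 G2 G3)
      (star_G2 c v G0 G1 G2 G3) (star_G3 c v G0 G1 G2 G3) X.
Proof.
rewrite /boost_sr /four_tensor tr_block_mx !mulmx_block !mul1mx !trmx1 !mulmx1.
congr block_mx; apply/matrixP => i j;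
  rewrite /star_G0 /star_G1 /star_G2 /star_G3 /outer /dot ?ord1;
  do !rewrite !mxE ?big_ord_recl ?big_ord0 /=.
all: rewrite ?ord1 ?mulr1n.
all: rewrite -?exprVn; ring.
Qed.

Lemma rotation_four_tensor (Q : 'M[R]_3) G0 G1 G2 G3 X :
  rotation Q *m four_tensor G0 G1 G2 G3 X *m (rotation Q)^T =
  block_mx (G0 X)%:M (Q *m G1 X)^T (Q *m G2 X) (Q *m G3 X *m Q^T).
Proof.
rewrite /rotation /four_tensor tr_block_mx !mulmx_block !trmx1 !trmx0.
by rewrite !(mul0mx, mulmx0, add0r, addr0, mul1mx, mulmx1) trmx_mul.
Qed.

Lemma rotation_four_vector (Q : 'M[R]_3) g0 g1 X :
  rotation Q *m four_vector g0 g1 X = col_mx (g0 X)%:M (Q *m g1 X).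
Proof.
by rewrite mul_block_col !(mul0mx, add0r, addr0, mul1mx).
Qed.

(** The spatial part is exactly the Galilean image, so the Lorentz and Galilean laws differ only in
    the time at which the second frame is evaluated. *)
Lemma lorentz_event Q u t x : c != 0 ->
  lorentz_sr c Q u *m event c t x =
  event c (t - dot u x / c ^+ 2) (galilean Q u t x).
Proof.
move=> c0; rewrite /lorentz_sr -mulmxA /boost_sr mul_block_col !mul1mx.
rewrite mul_block_col !(mul0mx, add0r, addr0, mul1mx); congr col_mx.
  apply/matrixP => i j; rewrite !ord1 /dot !mxE /=; under eq_bigr do rewrite !mxE.
  by rewrite !big_ord_recl !big_ord0 !mxE ?mulr1n; field.
rewrite mulmxDr addrC /galilean; congr (_ + _).
rewrite mul_mx_scalar scalerN scalerA mulrAC divff // mul1r.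
by rewrite -scaleNr -scalemxAr scaleNr.
Qed.

(** Orthogonality of [Q] moves the rotation to the left, leaving the product of the boosts of
    velocities [w - u] and [u]. In its off-diagonal blocks the velocities add up to [w]; the
    quadratic terms all fall in the diagonal blocks. *)
Lemma boost_compose Q u w : SO3 Q ->
  boost_sr c (Q *m (w - u)) *m lorentz_sr c Q u =
  rotation Q *m (boost_sr c w
    + block_mx (dot (w - u) u / c ^+ 2)%:M 0 0 (c ^- 2 *: outer (w - u) u)).
Proof.
move=> [QQ _]; have QTQ : Q^T *m Q = 1%:M by apply: mulmx1C.
have comm : boost_sr c (Q *m (w - u)) *m rotation Q =
    rotation Q *m boost_sr c (w - u).
  rewrite /boost_sr /rotation !mulmx_block.
  rewrite !(mul0mx, mulmx0, add0r, addr0, mul1mx, mulmx1).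
  rewrite mulNmx mulmxN -scalemxAl trmx_mul -mulmxA QTQ mulmx1.
  by rewrite -scalemxAr.
rewrite /lorentz_sr -[block_mx 1%:M 0 0 Q]/(rotation Q) mulmxA comm -mulmxA.
congr (_ *m _).
rewrite /boost_sr !mulmx_block !(mul1mx, mulmx1) add_block_mx.
congr block_mx; apply/matrixP => i j; rewrite ?ord1 /outer /dot;
  do !rewrite !mxE ?big_ord_recl ?big_ord0 /=.
all: rewrite ?ord1 ?mulr1n.
all: rewrite -?exprVn; ring.
Qed.

End Star.

(** * Propagation of errors through matrix products *)

Section Perturbation.
Variables (R : realType) (m : nat).

Lemma mx_bound_scale_mul (m1 n p : nat) (a b : R) (N M : 'M[R]_(m1, n))
    (N' M' : 'M[R]_(n, p)) :
  mx_bound (a *: N) M -> mx_bound (b *: N') M' ->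
  mx_bound ((a * b) *: (N *m N')) (M *m M').
Proof.
move=> MN MN'; have := mx_bound_mul MN MN'.
by rewrite -scalemxAl -scalemxAr scalerA.
Qed.

(** The error splits as [(P' - P) *m g + B *m T]: a defect [P' - P] of the transformation and a
    defect [T] of the field. *)
Lemma perturb_vector n (N P P' B : 'M[R]_m) (s g T : 'M[R]_(m, n)) (k q a b : R) :
  mx_bound (k *: N) B -> mx_bound (q *: N) (P' - P) ->
  mx_bound (a *: s) g -> mx_bound (b *: s) T ->
  mx_bound ((q * a + k * b) *: (N *m s)) (P' *m g + B *m T - P *m g).
Proof.
move=> NB NP sg sT; rewrite addrAC -mulmxBl scalerDl.
by apply: mx_boundD; exact: mx_bound_scale_mul.
Qed.

(** The defect [P' - P] enters once on the left, next to [P'^T], and once on the right, next to [P];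
    hence the factor 2. The field defect gives [k * b * k]. *)
Lemma perturb_tensor (N P P' B S G T : 'M[R]_m) (k q a b : R) :
  mx_bound (k *: N) B -> mx_bound (k *: N) P -> mx_bound (k *: N) P' ->
  mx_bound (q *: N) (P' - P) -> mx_bound (a *: S) G -> mx_bound (b *: S) T ->
  mx_bound ((2 * (q * a * k) + k * b * k) *: (N *m S *m N^T))
    (P' *m G *m P'^T + B *m T *m B^T - P *m G *m P^T).
Proof.
move=> NB NP NP' NPP SG ST.
have -> : P' *m G *m P'^T + B *m T *m B^T - P *m G *m P^T =
    (P' - P) *m G *m P'^T + P *m G *m (P' - P)^T + B *m T *m B^T.
  rewrite linearB /= mulmxBr !mulmxBl addrACA addrC.
  by apply/matrixP => i j; rewrite !mxE; ring.
have NT (l : R) (M : 'M[R]_m) : mx_bound (l *: N) M -> mx_bound (l *: N^T) M^T.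
  by move/mx_boundT; rewrite linearZ.
have -> : 2 * (q * a * k) + k * b * k = q * a * k + k * a * q + k * b * k by ring.
by rewrite !scalerDl; do 2?apply: mx_boundD;
   apply: mx_bound_scale_mul (NT _ _ _) => //; exact: mx_bound_scale_mul.
Qed.

End Perturbation.

(** * Orders in eps of boosts, rotations and the remainder *)

Section Sizes.
Variables (R : realType) (e : R).
Hypothesis e01 : 0 < e < 1.

Local Notation beta := (mx_sizes 1 e e 1).

Let e0 : 0 < e. Proof. by case/andP: e01. Qed.
Let e1 : e ^+ 2 <= 1. Proof. by rewrite expr_le1 // ltW //; case/andP: e01. Qed.

(** The blocks of the product are 1 + 3 e^2, 4 e, 4 e and e^2 + 3, and e^2 is at most 1. *)
Lemma boost_sizes_sqr : mx_bound (4%:R *: beta) (beta *m beta).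
Proof.
have e0' := e0; have e1' := e1.
by rewrite mulmx_sizes scale_mx_sizes; apply: mx_bound_sizes; apply/andP; split; nra.
Qed.

Lemma rotation_bound (Q : 'M[R]_3) : SO3 Q -> mx_bound beta (rotation Q).
Proof.
move=> SQ; apply/mx_bound_block; split=> i j; rewrite !mxE.
- by rewrite !ord1 eqxx normr1.
- by rewrite normr0 ltW.
- by rewrite normr0 ltW.
- exact: SO3_entry.
Qed.

Lemma boost_sr_bound (c K : R) (w : 'cV[R]_3) : 0 < c -> 0 <= K ->
  `|w| / c <= K * e -> mx_bound ((1 + K) *: beta) (boost_sr c w).
Proof.
move=> c0 K0 wc; have := e0 => e0'.
have wi i : `|w i 0| / c <= (1 + K) * e.
  have : `|w i 0| / c <= `|w| / c.
    by rewrite ler_pM2r ?invr_gt0 //; apply: (mx_norm_leP _ (normr_ge0 w)).1.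
  by move=> /le_trans/(_ wc)/le_trans; apply; rewrite ler_pM2r // lerDr.
have nwi i : `|- (c^-1 * w i 0)| <= (1 + K) * e.
  by rewrite normrN normrM (@gtr0_norm _ c^-1) ?invr_gt0 // [leLHS]mulrC.
rewrite scale_mx_sizes; apply/mx_bound_block; split=> i j; rewrite !mxE.
- by rewrite !ord1 eqxx normr1 mulr1 lerDl.
- by rewrite ord1.
- by rewrite ord1.
- by rewrite mulr1; case: (i == j); rewrite ?normr1 ?normr0; lra.
Qed.

(** Used with [w = v - u], whence the bound [2 * K * e]. The constant 6 is this 2 times the 3 from
    [dot_le]. *)
Lemma boost_remainder_bound (c K : R) (u w : 'cV[R]_3) : 0 < c -> 0 <= K ->
  `|u| / c <= K * e -> `|w| / c <= 2 * K * e ->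
  mx_bound ((6 * K ^+ 2 * e ^+ 2) *: beta)
    (block_mx (dot w u / c ^+ 2)%:M 0 0 (c ^- 2 *: outer w u)).
Proof.
move=> c0 K0 uc wc; have := e0 => e0'.
have wu : `|w| * `|u| / c ^+ 2 <= 2 * K ^+ 2 * e ^+ 2.
  rewrite (_ : _ / _ = `|w| / c * (`|u| / c)); last by rewrite -exprVn; ring.
  rewrite (_ : _ * e ^+ 2 = 2 * K * e * (K * e)); last by ring.
  by rewrite ler_pM // divr_ge0 // ltW.
have K2 : 0 <= 6 * K ^+ 2 * e ^+ 2 by apply: mulr_ge0; [apply: mulr_ge0|]; rewrite ?sqr_ge0 ?ler0n.
have c2 : 0 < c ^- 2 by rewrite invr_gt0 exprn_gt0.
rewrite scale_mx_sizes; apply/mx_bound_block; split=> i j; rewrite !mxE.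
- rewrite !ord1 eqxx mulr1n normrM (gtr0_norm c2).
  have := dot_le w u; rewrite -(ler_pM2r c2) => /le_trans; apply; lra.
- by rewrite normr0 mulr_ge0 // ltW.
- by rewrite normr0 mulr_ge0 // ltW.
rewrite big_ord_recl big_ord0 addr0 !mxE !normrM (gtr0_norm c2) mulrC.
have : `|w i 0| * `|u j 0| <= `|w| * `|u|.
  by rewrite ler_pM //; apply: (mx_norm_leP _ (normr_ge0 _)).1.
by rewrite -(ler_pM2r c2) => /le_trans; apply; lra.
Qed.

End Sizes.

(** * The change of frames under the semi-relativistic conditions *)

Section Frames.
Variables (R : realType) (K : R) (p : problem R).
Variables (Q : 'M[R]_3) (u : 'cV[R]_3) (v v' : 'cV[R]_(1 + 3) -> 'cV[R]_3).
Local Notation c := (lightspeed p).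
Local Notation e := (smallness p).
Local Notation beta := (mx_sizes 1 e e 1).
Local Notation k := (4 * (1 + K) + 24 * K ^+ 2).
Hypothesis SQ : SO3 Q.
Hypothesis sr : semi_relativistic K p u v v'.
Hypothesis vv' : velocity_law c Q u v v'.

(** Condition (I) gives 0 <= |u| / c <= K eps, with eps positive. *)
Lemma semi_relativistic_ge0 : 0 <= K.
Proof.
case: sr => -[c0 /andP[e0 _] _ _] uc _ _.
have : 0 <= K * e by apply: le_trans uc; rewrite divr_ge0 // ltW.
by rewrite pmulr_lge0.
Qed.

(** Here the relation between length and time scales enters: |u| <= K eps c and |x| <= K^2 eps c
    [t], so |u.x| / (c^2 [t]) is at most 3 K^3 eps^2. *)
Lemma time_shift_bound t (x : 'cV[R]_3) : in_range K p x ->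
  `|t - (t - dot u x / c ^+ 2)| / time_scale p <= 3 * K ^+ 3 * e ^+ 2.
Proof.
have K0 := semi_relativistic_ge0; rewrite /in_range => xr.
case: sr => -[c0 /andP[e0 _] _ tau0] uc _ lc.
rewrite subKr normrM (@gtr0_norm _ (c ^- 2)) ?invr_gt0 ?exprn_gt0 //.
have uK : `|u| <= K * e * c by rewrite -ler_pdivrMr.
have xK : `|x| <= K * (K * (e * c * time_scale p)).
  by apply: le_trans xr _; rewrite ler_wpM2l.
rewrite ler_pdivrMr // ler_pdivrMr ?exprn_gt0 //.
apply: le_trans (dot_le u x) _.
have := ler_pM (normr_ge0 u) (normr_ge0 x) uK xK; lra.
Qed.

(** [P] boosts to the rest frame and then rotates; [P'] passes to the second frame first and boosts
    to the rest frame there. *)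
Lemma frame_change_bounds t (x : 'cV[R]_3) :
  in_range K p x -> in_range K p (galilean Q u t x) ->
  let B := boost_sr c (v' (event c t (galilean Q u t x))) in
  let P := rotation Q *m boost_sr c (v (event c t x)) in
  let P' := B *m lorentz_sr c Q u in
  [/\ mx_bound (k *: beta) B, mx_bound (k *: beta) P, mx_bound (k *: beta) P'
    & mx_bound ((24 * K ^+ 2 * e ^+ 2) *: beta) (P' - P)].
Proof.
have K0 := semi_relativistic_ge0 => xr yr B P P'.
case: sr => -[c0 e01 _ _] uc vc _; have /andP[e0 e1] := e01.
have [wc _] := vc t _ xr; have [_ w'c] := vc t _ yr.
have e2 : e ^+ 2 <= 1 by rewrite expr_le1 // ltW.
have K2 : 0 <= K ^+ 2 by rewrite sqr_ge0.
have K2e : K ^+ 2 * e ^+ 2 <= K ^+ 2 by rewrite ler_piMr.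
have K2e0 : 0 <= K ^+ 2 * e ^+ 2 by rewrite mulr_ge0 ?sqr_ge0.
have scale_le (a b : R) : 0 <= a <= b -> mx_bound (b *: beta) (a *: beta).
  by move=> ab; rewrite !scale_mx_sizes; apply: mx_bound_sizes;
     rewrite ?mulr1 //; apply/andP; split; nra.
(* A rotation is itself bounded by [beta], so multiplying by it costs the factor 4 of
   [boost_sizes_sqr]. *)
have times4 (a : R) M : 0 <= a -> mx_bound (a *: beta) M ->
    mx_bound ((4 * a) *: beta) (rotation Q *m M).
  move=> a0 aM.
  have := mx_bound_mul (rotation_bound e01 SQ) aM.
  rewrite -scalemxAr => /mx_bound_trans; apply.
  by rewrite mulrC -scalerA; apply: mx_boundZ => //; exact: boost_sizes_sqr.
have BB : mx_bound (k *: beta) B.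
  apply: mx_bound_trans (boost_sr_bound e01 c0 K0 w'c) (scale_le _ _ _); lra.
have PB1 : mx_bound ((4 * (1 + K)) *: beta) P.
  by apply: times4 (boost_sr_bound e01 c0 K0 wc); lra.
have dPB : mx_bound ((24 * K ^+ 2 * e ^+ 2) *: beta) (P' - P).
  (* The velocity law puts [P'] in the form of [boost_compose]; subtracting [P] leaves the rotated
     remainder, of order eps^2. *)
  rewrite /P' /P /B vv' boost_compose // mulmxDr addrAC subrr add0r.
  have -> : 24 * K ^+ 2 * e ^+ 2 = 4 * (6 * K ^+ 2 * e ^+ 2) by ring.
  apply: times4; first lra.
  apply: boost_remainder_bound => //.
  apply: le_trans (_ : (`|v (event c t x)| + `|u|) / c <= _).
    by rewrite ler_pM2r ?invr_gt0 // ler_normB.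
  by rewrite mulrDl; lra.
split => //.
  by apply: mx_bound_trans PB1 (scale_le _ _ _); lra.
have -> : P' = P + (P' - P) by rewrite addrC subrK.
have := mx_boundD PB1 dPB; rewrite -scalerDl => /mx_bound_trans; apply.
by apply: scale_le; lra.
Qed.

End Frames.

(** * Sizes and time shifts of the four-dimensional fields *)

Section FieldSizes.
Variables (R : realType) (K : R) (A : nat -> nat -> R) (p : problem R).
Local Notation c := (lightspeed p).

Lemma four_vector_bound g0 g0' g1 g1' s0 s1 t x :
  typical K A p s0 g0 g0' -> typical K A p s1 g1 g1' -> in_range K p x ->
  mx_bound (`|A 0 0| *: col_sizes s0 s1) (four_vector g0 g1 (event c t x)).
Proof.
move=> h0 h1 xr; rewrite scale_col_sizes; apply/mx_bound_col; split.
  by move=> i j; rewrite !ord1 !mxE eqxx mulr1n; exact: typical_le h0 xr.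
by apply: mx_bound_const; exact: typical_le h1 xr.
Qed.

Lemma four_tensor_bound G0 G0' G1 G1' G2 G2' G3 G3' s0 s1 s2 s3 t x :
  typical K A p s0 G0 G0' -> typical K A p s1 G1 G1' ->
  typical K A p s2 G2 G2' -> typical K A p s3 G3 G3' -> in_range K p x ->
  mx_bound (`|A 0 0| *: mx_sizes s0 s1 s2 s3)
    (four_tensor G0 G1 G2 G3 (event c t x)).
Proof.
move=> h0 h1 h2 h3 xr; rewrite scale_mx_sizes; apply/mx_bound_block; split.
- by move=> i j; rewrite !ord1 !mxE eqxx mulr1n; exact: typical_le h0 xr.
- by rewrite -trmx_const; apply/mx_boundT/mx_bound_const; exact: typical_le h1 xr.
- by apply: mx_bound_const; exact: typical_le h2 xr.
- by apply: mx_bound_const; exact: typical_le h3 xr.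
Qed.

Hypothesis tau_gt0 : 0 < time_scale p.

(** [d] stands for the relative time shift, which is of order eps^2 in the application. *)
Lemma four_vector_shift g0 g0' g1 g1' s0 s1 t t' x d :
  typical K A p s0 g0 g0' -> typical K A p s1 g1 g1' -> in_range K p x ->
  `|t - t'| / time_scale p <= d ->
  mx_bound ((`|A 1 0| * d) *: col_sizes s0 s1)
    (four_vector g0' g1' (event c t x) - four_vector g0' g1' (event c t' x)).
Proof.
move=> h0 h1 xr td; rewrite scale_col_sizes opp_col_mx add_col_mx.
have [[s00 _ _] [s10 _ _]] := (h0, h1).
apply/mx_bound_col; split=> i j.
  rewrite !ord1 !mxE eqxx !mulr1n mulrAC.
  by apply: le_trans (typical_shift tau_gt0 t t' h0 xr) _;
     rewrite ler_wpM2l ?mulr_ge0.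
rewrite !mxE mulrAC.
by apply: le_trans (typical_shift_mx tau_gt0 t t' h1 xr i j) _;
     rewrite ler_wpM2l ?mulr_ge0.
Qed.

Lemma four_tensor_shift G0 G0' G1 G1' G2 G2' G3 G3' s0 s1 s2 s3 t t' x d :
  typical K A p s0 G0 G0' -> typical K A p s1 G1 G1' ->
  typical K A p s2 G2 G2' -> typical K A p s3 G3 G3' -> in_range K p x ->
  `|t - t'| / time_scale p <= d ->
  mx_bound ((`|A 1 0| * d) *: mx_sizes s0 s1 s2 s3)
    (four_tensor G0' G1' G2' G3' (event c t x)
     - four_tensor G0' G1' G2' G3' (event c t' x)).
Proof.
move=> h0 h1 h2 h3 xr td; rewrite scale_mx_sizes opp_block_mx add_block_mx.
have [[[s00 _ _] [s10 _ _]] [[s20 _ _] [s30 _ _]]] := ((h0, h1), (h2, h3)).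
apply/mx_bound_block; split=> i j; rewrite !mxE mulrAC.
- rewrite !ord1 eqxx !mulr1n.
  by apply: le_trans (typical_shift tau_gt0 t t' h0 xr) _;
     rewrite ler_wpM2l ?mulr_ge0.
- by apply: le_trans (typical_shift_mx tau_gt0 t t' h1 xr j i) _;
     rewrite ler_wpM2l ?mulr_ge0.
- by apply: le_trans (typical_shift_mx tau_gt0 t t' h2 xr i j) _;
     rewrite ler_wpM2l ?mulr_ge0.
- by apply: le_trans (typical_shift_mx tau_gt0 t t' h3 xr i j) _;
     rewrite ler_wpM2l ?mulr_ge0.
Qed.

End FieldSizes.

(** * Errors of the individual components *)

Section ComponentErrors.
Variables (R : realType) (e s0 s1 s2 s3 : R).
Local Notation beta := (mx_sizes 1 e e 1).

(** The blocks of [beta *m col_sizes s0 s1] are s0 + 3 e s1 and e s0 + 3 s1, whence the factor 3. *)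
Lemma vector_error_read (M : R) (Q : 'M[R]_3) f0 f0' f1 f1' (X Y : 'cV[R]_(1 + 3)) :
  0 < e < 1 -> 0 <= s0 -> 0 <= s1 -> 0 <= M ->
  mx_bound (M *: (beta *m col_sizes s0 s1))
    (four_vector f0' f1' Y - rotation Q *m four_vector f0 f1 X) ->
  `|f0' Y - f0 X| <= 3 * M * (s0 + e * s1) /\
  `|f1' Y - Q *m f1 X| <= 3 * M * (s1 + e * s0).
Proof.
move=> e01 s0_ge0 s1_ge0 M0; have /andP[e0 e1] := e01.
have es0 : 0 <= e * s0 by rewrite mulr_ge0 // ltW.
have es1 : 0 <= e * s1 by rewrite mulr_ge0 // ltW.
have fin (x y : R) : x <= 3 * y -> M * x <= 3 * M * y.
  by move=> xy; rewrite [leRHS]mulrAC [leRHS]mulrC ler_wpM2l.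
rewrite rotation_four_vector opp_col_mx add_col_mx mul_mx_col_sizes scale_col_sizes.
case/mx_bound_col => h0 h1; split.
  have := h0 0 0; rewrite !mxE !mulr1n => /le_trans; apply.
  by apply: fin; lra.
apply/mx_norm_leP; first by rewrite !mulr_ge0 // addr_ge0.
move=> i j; have := h1 i j; rewrite [in leRHS]mxE => /le_trans; apply.
by apply: fin; lra.
Qed.

(** Multiplying by [beta] on both sides sums over spatial indices at most twice, so every
    coefficient is at most 9. *)
Lemma tensor_error_read (M : R) (Q : 'M[R]_3) F0 F0' F1 F1' F2 F2' F3 F3'
    (X Y : 'cV[R]_(1 + 3)) :
  0 < e < 1 -> 0 <= s0 -> 0 <= s1 -> 0 <= s2 -> 0 <= s3 -> 0 <= M ->
  mx_bound (M *: (beta *m mx_sizes s0 s1 s2 s3 *m beta^T))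
    (four_tensor F0' F1' F2' F3' Y
     - rotation Q *m four_tensor F0 F1 F2 F3 X *m (rotation Q)^T) ->
  [/\ `|F0' Y - F0 X| <= 9 * M * (s0 + e * s1 + e * s2 + e ^+ 2 * s3),
      `|F1' Y - Q *m F1 X| <= 9 * M * (s1 + e * s0 + e ^+ 2 * s2 + e * s3),
      `|F2' Y - Q *m F2 X| <= 9 * M * (s2 + e * s0 + e ^+ 2 * s1 + e * s3)
    & `|F3' Y - Q *m F3 X *m Q^T|
        <= 9 * M * (s3 + e ^+ 2 * s0 + e * s1 + e * s2)].
Proof.
move=> e01 s0_ge0 s1_ge0 s2_ge0 s3_ge0 M0; have /andP[e0 e1] := e01.
have es s : 0 <= s -> 0 <= e * s by move=> ?; rewrite mulr_ge0 // ltW.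
have ees s : 0 <= s -> 0 <= e ^+ 2 * s by move=> ?; rewrite mulr_ge0 // sqr_ge0.
have := (es _ s0_ge0, es _ s1_ge0, es _ s2_ge0, es _ s3_ge0).
have := (ees _ s0_ge0, ees _ s1_ge0, ees _ s2_ge0, ees _ s3_ge0).
case=> [[[a0 a1] a2] a3] [[[b0 b1] b2] b3].
have fin (x y : R) : x <= 9 * y -> M * x <= 9 * M * y.
  by move=> xy; rewrite [leRHS]mulrAC [leRHS]mulrC ler_wpM2l.
have betaT : beta^T = beta by rewrite /mx_sizes tr_block_mx !trmx_const.
rewrite rotation_four_tensor betaT !mulmx_sizes scale_mx_sizes.
rewrite opp_block_mx add_block_mx -linearB /=.
case/mx_bound_block => h0 h1 h2 h3; split.
- have := h0 0 0; rewrite !mxE !mulr1n => /le_trans; apply.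
  by apply: fin; lra.
- apply/mx_norm_leP; first by rewrite !mulr_ge0 // !addr_ge0.
  move=> i j; have := h1 j i; rewrite mxE [in leRHS]mxE => /le_trans; apply.
  by apply: fin; lra.
- apply/mx_norm_leP; first by rewrite !mulr_ge0 // !addr_ge0.
  move=> i j; have := h2 i j; rewrite [in leRHS]mxE => /le_trans; apply.
  by apply: fin; lra.
- apply/mx_norm_leP; first by rewrite !mulr_ge0 // !addr_ge0.
  move=> i j; have := h3 i j; rewrite [in leRHS]mxE => /le_trans; apply.
  by apply: fin; lra.
Qed.

End ComponentErrors.

(* Each error is C eps^2 times the typical size of the starred field, i.e. the
   sum of the typical sizes of the terms defining it, with [v] = eps c. *)
Theorem proposition15 (R : realType) (K : R) (A : nat -> nat -> R) :
  exists C : R,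
  forall (p : problem R) (Q : 'M[R]_3) (u : 'cV[R]_3)
    (v v' : 'cV[R]_(1 + 3) -> 'cV[R]_3)
    (g0 g0' G0 G0' : 'cV[R]_(1 + 3) -> R)
    (g1 g1' G1 G1' G2 G2' : 'cV[R]_(1 + 3) -> 'cV[R]_3)
    (G3 G3' : 'cV[R]_(1 + 3) -> 'M[R]_3)
    (sv sg0 sg1 sG0 sG1 sG2 sG3 : R),
  let c := lightspeed p in
  let e := smallness p in
  SO3 Q ->
  semi_relativistic K p u v v' ->
  velocity_law c Q u v v' ->
  lorentz_vector (lorentz_sr c Q u) (four_vector g0 g1) (four_vector g0' g1') ->
  lorentz_tensor (lorentz_sr c Q u)
    (four_tensor G0 G1 G2 G3) (four_tensor G0' G1' G2' G3') ->
  typical K A p sv v v' ->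
  typical K A p sg0 g0 g0' -> typical K A p sg1 g1 g1' ->
  typical K A p sG0 G0 G0' -> typical K A p sG1 G1 G1' ->
  typical K A p sG2 G2 G2' -> typical K A p sG3 G3 G3' ->
  [/\ galilean_scalar K p Q u (C * e ^+ 2 * (sg0 + e * sg1))
        (star_g0 c v g0 g1) (star_g0 c v' g0' g1')
    & galilean_vector K p Q u (C * e ^+ 2 * (sg1 + e * sg0))
        (star_g1 c v g0 g1) (star_g1 c v' g0' g1')] /\
  [/\ galilean_scalar K p Q u
        (C * e ^+ 2 * (sG0 + e * sG1 + e * sG2 + e ^+ 2 * sG3))
        (star_G0 c v G0 G1 G2 G3) (star_G0 c v' G0' G1' G2' G3'),
      galilean_vector K p Q u
        (C * e ^+ 2 * (sG1 + e * sG0 + e ^+ 2 * sG2 + e * sG3))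
        (star_G1 c v G0 G1 G2 G3) (star_G1 c v' G0' G1' G2' G3'),
      galilean_vector K p Q u
        (C * e ^+ 2 * (sG2 + e * sG0 + e ^+ 2 * sG1 + e * sG3))
        (star_G2 c v G0 G1 G2 G3) (star_G2 c v' G0' G1' G2' G3')
    & galilean_tensor K p Q u
        (C * e ^+ 2 * (sG3 + e ^+ 2 * sG0 + e * sG1 + e * sG2))
        (star_G3 c v G0 G1 G2 G3) (star_G3 c v' G0' G1' G2' G3')].
Proof.
(* [k] bounds the transformations, [a] the fields, and [b] times eps^2 the time shift; [mv] and [mt]
   are the perturbation constants with eps^2 factored out. All depend on [K] and [A] alone, so the
   final constant is uniform over problems. *)
pose k := 4 * (1 + K) + 24 * K ^+ 2.
pose a : R := `|A 0 0|; pose b : R := `|A 1 0| * (3 * K ^+ 3).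
pose mv := 24 * K ^+ 2 * a + k * b.
pose mt := 2 * (24 * K ^+ 2 * a * k) + k * b * k.
exists (9 * (mv + mt)) => p Q u v v' g0 g0' G0 G0' g1 g1' G1 G1' G2 G2' G3 G3'.
move=> sv sg0 sg1 sG0 sG1 sG2 sG3 c e SQ sr vv' gg' GG' _ tg0 tg1 tG0 tG1 tG2 tG3.
have K0 := semi_relativistic_ge0 sr.
have [[c0 e01 l0 tau0] _ _ _] := sr.
have k0 : 0 <= k by rewrite /k; have := sqr_ge0 K; lra.
have a0 : 0 <= a by exact: normr_ge0.
have b0 : 0 <= b by rewrite /b !mulr_ge0 // exprn_ge0.
have mv0 : 0 <= mv by rewrite /mv addr_ge0 // !mulr_ge0 // sqr_ge0.
have mt0 : 0 <= mt by rewrite /mt addr_ge0 // !mulr_ge0 // sqr_ge0.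
have e2 : 0 <= e ^+ 2 by exact: sqr_ge0.
have scale_ge0 (V : normedModType R) F (f f' : 'cV[R]_(1 + 3) -> V) :
    typical K A p F f f' -> 0 <= F by case.
have [s00 s10] := (scale_ge0 _ _ _ _ tg0, scale_ge0 _ _ _ _ tg1).
have [S00 S10] := (scale_ge0 _ _ _ _ tG0, scale_ge0 _ _ _ _ tG1).
have [S20 S30] := (scale_ge0 _ _ _ _ tG2, scale_ge0 _ _ _ _ tG3).
have C_ge (m r s : R) : 0 <= s -> r * m <= 9 * (mv + mt) ->
    r * (m * e ^+ 2) * s <= 9 * (mv + mt) * e ^+ 2 * s.
  by move=> s0 rm; rewrite mulrA ler_wpM2r // ler_wpM2r.
have mul_ge0 s : 0 <= s -> 0 <= e * s.
  by move=> ?; rewrite mulr_ge0 // ltW //; case/andP: e01.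
have vector_err t x : in_range K p x -> in_range K p (galilean Q u t x) ->
    mx_bound ((mv * e ^+ 2) *: (mx_sizes 1 e e 1 *m col_sizes sg0 sg1))
      (four_vector (star_g0 c v' g0' g1') (star_g1 c v' g0' g1')
         (event c t (galilean Q u t x))
       - rotation Q *m four_vector (star_g0 c v g0 g1) (star_g1 c v g0 g1)
           (event c t x)).
  move=> xr yr; have [BB _ _ PP] := frame_change_bounds SQ sr vv' xr yr.
  have T := four_vector_shift tau0 tg0 tg1 yr (time_shift_bound sr t xr).
  have := perturb_vector BB PP (four_vector_bound t tg0 tg1 xr) T.
  (* The shifted event is the Lorentz image of X, so [T] is g'(Y) - L g(X). As [P'] is B L, the sum
     P' g(X) + B T collapses to B g'(Y), the starred field of the second frame. *)
  rewrite -lorentz_event ?gt_eqF // gg' -!star_four_vector.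
  congr (mx_bound (_ *: _) _); first by rewrite /mv /b /a /k /e; ring.
  by rewrite mulmxBr !mulmxA [X in X - _ = _]addrC subrK.
have tensor_err t x : in_range K p x -> in_range K p (galilean Q u t x) ->
    mx_bound ((mt * e ^+ 2) *: (mx_sizes 1 e e 1 *m mx_sizes sG0 sG1 sG2 sG3
        *m (mx_sizes 1 e e 1)^T))
      (four_tensor (star_G0 c v' G0' G1' G2' G3') (star_G1 c v' G0' G1' G2' G3')
         (star_G2 c v' G0' G1' G2' G3') (star_G3 c v' G0' G1' G2' G3')
         (event c t (galilean Q u t x))
       - rotation Q *m four_tensor (star_G0 c v G0 G1 G2 G3)
           (star_G1 c v G0 G1 G2 G3) (star_G2 c v G0 G1 G2 G3)
           (star_G3 c v G0 G1 G2 G3) (event c t x) *m (rotation Q)^T).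
  move=> xr yr; have [BB PB P'B PP] := frame_change_bounds SQ sr vv' xr yr.
  have T := four_tensor_shift tau0 tG0 tG1 tG2 tG3 yr (time_shift_bound sr t xr).
  have := perturb_tensor BB PB P'B PP (four_tensor_bound t tG0 tG1 tG2 tG3 xr) T.
  (* The same cancellation on both sides: P' G P'^T equals B (L G L^T) B^T. *)
  rewrite -lorentz_event ?gt_eqF // GG' -!star_four_tensor.
  congr (mx_bound (_ *: _) _); first by rewrite /mt /b /a /k /e; ring.
  by rewrite mulmxBr mulmxBl !trmx_mul !mulmxA [X in X - _ = _]addrC subrK.
split; split=> t x xr yr.
- have [/le_trans-> //] :=
    vector_error_read e01 s00 s10 (mulr_ge0 mv0 e2) (vector_err t x xr yr).
  by apply: C_ge; [rewrite !addr_ge0 ?mul_ge0|lra].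
- have [_ /le_trans-> //] :=
    vector_error_read e01 s00 s10 (mulr_ge0 mv0 e2) (vector_err t x xr yr).
  by apply: C_ge; [rewrite !addr_ge0 ?mul_ge0|lra].
all: have [h0 h1 h2 h3] := tensor_error_read e01 S00 S10 S20 S30
  (mulr_ge0 mt0 e2) (tensor_err t x xr yr).
- apply: le_trans h0 _; apply: C_ge; [rewrite !addr_ge0 ?mul_ge0 // mulr_ge0 //|lra].
- apply: le_trans h1 _; apply: C_ge; [rewrite !addr_ge0 ?mul_ge0 // mulr_ge0 //|lra].
- apply: le_trans h2 _; apply: C_ge; [rewrite !addr_ge0 ?mul_ge0 // mulr_ge0 //|lra].
- apply: le_trans h3 _; apply: C_ge; [rewrite !addr_ge0 ?mul_ge0 // mulr_ge0 //|lra].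
Qed.
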